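(* Let $G$ be a group and let $S\subset G$ be a finite subset with $1\in S$. Let $M$ be a $u$-kernel of $S$ which is a subgroup of $G$, and let $N$ be a subgroup of $G$ which is a $v$-cell of $S$, where $u,v\le |S|-1$. \begin{itemize} \item[(i)] If either $N$ is a $v$-kernel of $S$ or $u=v$, then $M\subset N$ or $N\subset M$. \item[(ii)] If $N$ is a $v$-kernel of $S$ and $v\le u$, then $M\subset N$. \end{itemize}
   Context: For subsets $X,Y$ of a group $G$, $XY=\{xy: x\in X, y\in Y\}$ and $zY=\{z\}Y$. Let $S$ be a finite subset of $G$ with $1\in S$. A cell of $S$ is a finite subset $X\subset G$ such that for every $z\in G\setminus X$ one has $zS\not\subset XS$. For an integer $u$, a $u$-cell of $S$ is a cell $X$ of $S$ with $|XS|-|X|=u$. A $u$-kernel of $S$ is a $u$-cell of $S$ of minimal cardinality among all $u$-cells of $S$. *)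

(* Defs.v *)
From mathcomp Require Import all_boot all_order all_algebra all_fingroup finmap.

Set Implicit Arguments.
Unset Strict Implicit.
Unset Printing Implicit Defensive.

Local Open Scope fset_scope.
Local Open Scope group_scope.

Definition setprod (G : groupType) (X Y : {fset G}) : {fset G} :=
  [fset x * y | x in X, y in Y].

(* The empty set is not excluded: it is a 0-cell as soon as S is nonempty. *)
Definition cell (G : groupType) (S X : {fset G}) : Prop :=
  forall z : G, z \notin X -> ~~ (setprod [fset z] S `<=` setprod X S).

Definition ucell (G : groupType) (S : {fset G}) (u : int) (X : {fset G}) : Prop :=
  cell S X /\ (#|` setprod X S|%:Z - #|` X|%:Z)%R = u.

Definition ukernel (G : groupType) (S : {fset G}) (u : int) (X : {fset G}) : Prop :=
  ucell S u X /\ forall Y : {fset G}, ucell S u Y -> #|` X| <= #|` Y|.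

Definition is_subgroup (G : groupType) (X : {fset G}) : Prop :=
  group_closed (mem X).

(* Main.v *)
Require Import Defs.
From Stdlib Require Import Classical.
From mathcomp Require Import all_boot all_order all_algebra all_fingroup finmap zify.

(* Write [m], [n], [h] for the orders of [M], [N] and [H := M `&` N], and
   [excess E := |M E| + |N E| - 2 |E|].  Suppose that neither of [M], [N] contains
   the other.

   The boundary [w := |H S| - h] is a multiple of [h], as are [u] and [v], and
   [|H S| >= |S|] exceeds [u] and [v]; so [w >= u] and [w >= v], and [w > u] since
   [H] is a cell smaller than the [u]-kernel [M].  Hence [E := H S] satisfies
   [excess E = m + n - 2h + (u + v - 2w) < m + n - 2h].

   On the other hand [excess] is submodular and invariant under right translation.
   If no finite subgroup contains [M] and [N], a nonempty set that minimizes first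
   [excess] and then the cardinality is disjoint from its other translates, so it
   is a coset of a subgroup [F]; then [F] contains [H] but not both [M] and [N], and
   counting cosets gives [excess F >= m + n - 2h].  If [K] is the smallest finite
   subgroup containing [M] and [N], the same holds inside [K] for sets [X] such that
   [M X] and [N X] do not cover [K].  So [M E] and [N E] cover every right coset of
   [K] that they meet.  As [M] and [N] are cells, there are [z] in [M E] outside
   [N E] and [y] in [N E] outside [M E]; then [N z] lies in [M E] minus [N E] and
   [M y] lies in [N E] minus [M E], which forces [excess E >= m + n]. *)

Local Open Scope fset_scope.
Local Open Scope group_scope.

(** * Product sets and right translates *)

Local Notation "A ** B" := (setprod A B) (at level 40, left associativity).

Lemma setprodP {G : groupType} {A B : {fset G}} {z : G} :
  reflect (exists2 a, a \in A & exists2 b, b \in B & z = a * b) (z \in A ** B).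
Proof. exact: imfset2P. Qed.

Lemma mem_setprod (G : groupType) (A B : {fset G}) (a b : G) :
  a \in A -> b \in B -> a * b \in A ** B.
Proof. by move=> aA bB; apply/setprodP; exists a => //; exists b. Qed.

Lemma setprodA (G : groupType) (A B C : {fset G}) : A ** (B ** C) = A ** B ** C.
Proof.
apply/fsetP=> z; apply/setprodP/setprodP.
  move=> [a aA [_ /setprodP[b bB [c cC ->]] ->]]; exists (a * b).
    exact: mem_setprod.
  by exists c; rewrite // mulgA.
move=> [_ /setprodP[a aA [b bB ->]] [c cC ->]]; exists a => //.
by exists (b * c); [exact: mem_setprod | rewrite mulgA].
Qed.

Lemma setprodS {G : groupType} {A A' B B' : {fset G}} :
  A `<=` A' -> B `<=` B' -> A ** B `<=` A' ** B'.
Proof.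
move=> /fsubsetP sA /fsubsetP sB; apply/fsubsetP=> _ /setprodP[a aA [b bB ->]].
by apply: mem_setprod; [exact: sA | exact: sB].
Qed.

Lemma setprodU (G : groupType) (A B C : {fset G}) :
  A ** (B `|` C) = (A ** B) `|` (A ** C).
Proof.
apply/fsetP=> z; apply/setprodP/fsetUP.
  move=> [a aA [b /fsetUP[bB|bC] ->]]; [left|right]; exact: mem_setprod.
case=> /setprodP[a aA [b bB ->]]; exists a => //; exists b => //;
  apply/fsetUP; by [left|right].
Qed.

Lemma setprod0 (G : groupType) (A : {fset G}) : A ** fset0 = fset0.
Proof. by apply/fsetP=> z; apply/setprodP => -[a _ []]. Qed.

Lemma mem_rcoset (G : groupType) (A : {fset G}) (g z : G) :
  (z \in A ** [fset g]) = (z * g^-1 \in A).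
Proof.
apply/setprodP/idP => [[a aA [_ /fset1P-> ->]]|zA]; first by rewrite mulgK.
by exists (z * g^-1) => //; exists g; rewrite ?fset11 // mulgVK.
Qed.

Lemma card_rcoset (G : groupType) (A : {fset G}) (g : G) :
  #|` A ** [fset g]| = #|` A|.
Proof.
have -> : A ** [fset g] = [fset x * g | x in A].
  apply/fsetP=> z; rewrite mem_rcoset; apply/idP/imfsetP => [zA|[x xA ->]].
    by exists (z * g^-1); rewrite // mulgVK.
  by rewrite mulgK.
by apply: card_imfset; exact: mulIg.
Qed.

(** * Finite subgroups and counting by cosets *)

Section Subgroups.

Context {G : groupType}.
Implicit Types A B H M S X : {fset G}.

Lemma subgroup1 {M} : is_subgroup M -> 1 \in M.
Proof. by case. Qed.

Lemma subgroupV {M} (x : G) : is_subgroup M -> x \in M -> x^-1 \in M.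
Proof. by move=> /group_closedV h /h. Qed.

Lemma subgroupM {M} (x y : G) : is_subgroup M -> x \in M -> y \in M -> x * y \in M.
Proof. by move=> /group_closedM h xM yM; apply: h. Qed.

Lemma subgroupI M N : is_subgroup M -> is_subgroup N -> is_subgroup (M `&` N).
Proof.
move=> [M1 Md] [N1 Nd]; split=> [|x y]; rewrite !inE; first by rewrite M1 N1.
by move=> /andP[xM xN] /andP[yM yN]; rewrite Md ?Nd.
Qed.

Lemma subgroup_card_gt0 M : is_subgroup M -> 0 < #|` M|.
Proof. by move=> /subgroup1 M1; rewrite cardfs_gt0; apply/fset0Pn; exists 1. Qed.

Lemma sub_setprod M S : is_subgroup M -> S `<=` M ** S.
Proof.
move=> gM; apply/fsubsetP=> x xS; rewrite -[x]mul1g; apply: mem_setprod => //.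
exact: subgroup1.
Qed.

Lemma setprod_subr X S : 1 \in S -> X `<=` X ** S.
Proof.
by move=> S1; apply/fsubsetP=> x xX; rewrite -[x]mulg1; apply: mem_setprod.
Qed.

Lemma setprodid M : is_subgroup M -> M ** M = M.
Proof.
move=> gM; apply/eqP; rewrite eqEfsubset sub_setprod // andbT.
by apply/fsubsetP=> _ /setprodP[x xM [y yM ->]]; exact: subgroupM.
Qed.

Lemma setprodK M S : is_subgroup M -> M ** (M ** S) = M ** S.
Proof. by move=> gM; rewrite setprodA setprodid. Qed.

Lemma setprod_sub {M K S} : is_subgroup K -> M `<=` K -> S `<=` K -> M ** S `<=` K.
Proof. by move=> gK sM sS; rewrite -(setprodid _ gK); exact: setprodS. Qed.

Lemma mem_setprodM {M S} (a x : G) : is_subgroup M -> a \in M ->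
  (a * x \in M ** S) = (x \in M ** S).
Proof.
move=> gM aM; apply/idP/idP => h; last by rewrite -setprodK // mem_setprod.
by rewrite -(mulKg a x) -setprodK // mem_setprod // subgroupV.
Qed.

Lemma rcoset_sub M S (x : G) : is_subgroup M ->
  (M ** [fset x] `<=` M ** S) = (x \in M ** S).
Proof.
move=> gM; apply/fsubsetP/idP => [h|xMS z].
  by apply: h; rewrite mem_rcoset mulgV subgroup1.
by rewrite mem_rcoset => zx; rewrite -(mulgVK x z) mem_setprodM.
Qed.

(** Removing one coset [H x] from a left [H]-invariant set leaves an invariant set, so cosets can be
    counted by induction without forming a quotient. *)
Lemma invariant_ind H (P : {fset G} -> Prop) : is_subgroup H ->
  P fset0 ->
  (forall x X, H ** X = X -> x \notin X -> P X -> P (H ** [fset x] `|` X)) ->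
  forall X, H ** X = X -> P X.
Proof.
move=> gH P0 PS X; have [n] := ubnP #|` X|; elim: n X => // n IHn X ltXn HX.
have [->//|/fset0Pn[x xX]] := eqVneq X fset0.
have sxX : H ** [fset x] `<=` X by rewrite -HX rcoset_sub // HX.
pose Y := X `\` (H ** [fset x]).
have HY : H ** Y = Y.
  apply/eqP; rewrite eqEfsubset sub_setprod // andbT.
  apply/fsubsetP=> _ /setprodP[h hH [y + ->]]; rewrite !in_fsetD !mem_rcoset.
  move=> /andP[yx yX]; rewrite -HX mem_setprodM // HX yX andbT.
  apply: contra yx => hyx; rewrite -(mulKg h y) -mulgA.
  by apply: subgroupM => //; exact: subgroupV.
have xY : x \notin Y by rewrite in_fsetD mem_rcoset mulgV subgroup1.
have -> : X = H ** [fset x] `|` Y.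
  by apply/fsetP=> z; rewrite !inE; have [/(fsubsetP sxX)->|] := boolP (z \in H ** _).
apply: PS => //; apply: IHn => //; rewrite -ltnS; apply: leq_trans ltXn.
have := subgroup_card_gt0 _ gH; have := fsubset_leq_card sxX.
rewrite cardfsDS // card_rcoset; lia.
Qed.

Lemma dvdn_card_invariant H X : is_subgroup H -> H ** X = X -> #|` H| %| #|` X|.
Proof.
move=> gH; move: X; apply: (invariant_ind H) => // x X HX xX IH.
have d : H ** [fset x] `&` X = fset0.
  apply/fsetP=> z; rewrite !inE; apply/negP=> /andP[zx zX].
  case/negP: xX; rewrite mem_rcoset in zx.
  by rewrite -HX -(mem_setprodM (z * x^-1)) // mulgVK HX.
have := cardfsUI (H ** [fset x]) X.
by rewrite d cardfs0 addn0 card_rcoset => ->; rewrite dvdn_add.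
Qed.

(** [B] is a disjoint union of cosets [(A & B) x], and distinct ones yield disjoint cosets [A x]. *)
Lemma card_setprodI A B : is_subgroup A -> is_subgroup B ->
  (#|` A ** B| * #|` A `&` B| = #|` A| * #|` B|)%N.
Proof.
move=> gA gB; have gI := subgroupI _ _ gA gB.
suff /(_ B) h X : (A `&` B) ** X = X -> X `<=` B ->
    (#|` A ** X| * #|` A `&` B| = #|` A| * #|` X|)%N.
  apply: h => //; apply/eqP; rewrite eqEfsubset sub_setprod // andbT.
  by apply: setprod_sub => //; exact: fsubsetIr.
move: X; apply: (invariant_ind (A `&` B)) => // [_|x X HX xX IH].
  by rewrite setprod0 !cardfs0 muln0.
rewrite fsubUset => /andP[/fsubsetP sxB sXB].
have xB : x \in B by apply: sxB; rewrite mem_rcoset mulgV subgroup1.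
have AI : A ** (A `&` B) = A.
  apply/eqP; rewrite eqEfsubset; apply/andP; split.
    by apply: setprod_sub => //; exact: fsubsetIl.
  by apply: setprod_subr => //; exact: subgroup1.
have dI : (A `&` B) ** [fset x] `&` X = fset0.
  apply/fsetP=> z; rewrite !inE; apply/negP=> /andP[zx zX].
  case/negP: xX; rewrite mem_rcoset in zx.
  by rewrite -HX -(mem_setprodM (z * x^-1)) // mulgVK HX.
have dA : (A ** [fset x]) `&` (A ** X) = fset0.
  apply/fsetP=> z; rewrite !inE; apply/negP=> /andP[].
  rewrite mem_rcoset => zA /setprodP[a aA [y yX zE]].
  case/negP: xX; rewrite -HX -(mem_setprodM (y * x^-1)) ?mulgVK ?HX //.
  rewrite in_fsetI; apply/andP; split.
    rewrite -[y](mulKg a) -zE -mulgA; apply: subgroupM => //; exact: subgroupV.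
  by apply: subgroupM => //; [exact: (fsubsetP sXB) | exact: subgroupV].
rewrite setprodU setprodA AI.
have := cardfsUI (A ** [fset x]) (A ** X).
have := cardfsUI ((A `&` B) ** [fset x]) X.
rewrite dI dA !cardfs0 !addn0 !card_rcoset => -> ->.
by rewrite mulnDl mulnDr IH.
Qed.

(** For [x] in [M] outside [F], the coset of [M & F] through [x] is a second, disjoint coset inside
    [M]. *)
Lemma proper_subgroup_card M F : is_subgroup M -> is_subgroup F ->
  ~~ (M `<=` F) -> #|` M `&` F|.*2 <= #|` M|.
Proof.
move=> gM gF /fsubsetPn[x xM xF]; have gI := subgroupI _ _ gM gF.
have d : (M `&` F) `&` ((M `&` F) ** [fset x]) = fset0.
  apply/fsetP=> z; rewrite in_fsetI mem_rcoset !in_fsetI; apply/negP.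
  move=> /andP[/andP[zM zF] /andP[_ zxF]]; case/negP: xF.
  rewrite -(mulgVK z x) -[x * z^-1]invgK invMg invgK.
  by apply: subgroupM => //; exact: subgroupV.
rewrite -addnn -{2}(card_rcoset _ (M `&` F) x) -cardfsUI d cardfs0 addn0.
apply: fsubset_leq_card; rewrite fsubUset fsubsetIl /=.
apply: setprod_sub => //; first exact: fsubsetIl.
by rewrite fsub1set.
Qed.

End Subgroups.

(** * The excess of a finite set: closure and submodularity *)

Section Excess.

Context {G : groupType} (M N : {fset G}).
Hypotheses (gM : is_subgroup M) (gN : is_subgroup N).
Implicit Types (F K S T X : {fset G}) (P : {fset G} -> Prop).

(** The natural subtraction never truncates, since [M S] and [N S] both contain [S]. *)
Definition excess S : nat := (#|` M ** S| + #|` N ** S|) - #|` S|.*2.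

Lemma excessE S : (excess S + #|` S|.*2 = #|` M ** S| + #|` N ** S|)%N.
Proof.
have := fsubset_leq_card (sub_setprod _ S gM).
have := fsubset_leq_card (sub_setprod _ S gN); rewrite /excess; lia.
Qed.

Lemma excess_rcoset S (g : G) : excess (S ** [fset g]) = excess S.
Proof. by rewrite /excess !setprodA !card_rcoset. Qed.

Lemma excess_submodular S T :
  excess (S `&` T) + excess (S `|` T) <= excess S + excess T.
Proof.
have sub X : #|` X ** (S `&` T)| + #|` X ** (S `|` T)| <= #|` X ** S| + #|` X ** T|.
  rewrite -(cardfsUI (X ** S)) setprodU addnC leq_add2l.
  by apply: fsubset_leq_card; rewrite fsubsetI !setprodS ?fsubsetIl ?fsubsetIr.
have := sub M; have := sub N; have := cardfsUI S T.
have := excessE (S `&` T); have := excessE (S `|` T).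
have := excessE S; have := excessE T; lia.
Qed.

Lemma sub_setprodI S : S `<=` (M ** S) `&` (N ** S).
Proof. by rewrite fsubsetI !sub_setprod. Qed.

(** [M S & N S] is the largest set with the same two products as [S]; replacing [S] by it can only
    lower the excess. *)
Lemma setprodIl S : M ** ((M ** S) `&` (N ** S)) = M ** S.
Proof.
apply/eqP; rewrite eqEfsubset (setprodS _ (sub_setprodI S)) // andbT.
by rewrite -{2}(setprodK _ S gM) setprodS // fsubsetIl.
Qed.

Lemma setprodIr S : N ** ((M ** S) `&` (N ** S)) = N ** S.
Proof.
apply/eqP; rewrite eqEfsubset (setprodS _ (sub_setprodI S)) // andbT.
by rewrite -{2}(setprodK _ S gN) setprodS // fsubsetIr.
Qed.

Lemma excess_setprodI S :
  (excess ((M ** S) `&` (N ** S)) + #|` (M ** S) `&` (N ** S)|.*2 =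
   #|` M ** S| + #|` N ** S|)%N.
Proof. by rewrite excessE setprodIl setprodIr. Qed.

Lemma excess_symdiff S :
  #|` (M ** S) `\` (N ** S)| + #|` (N ** S) `\` (M ** S)| <= excess S.
Proof.
have := cardfsID (N ** S) (M ** S); have := cardfsID (M ** S) (N ** S).
rewrite (fsetIC (N ** S)); have := fsubset_leq_card (sub_setprodI S).
have := excessE S; lia.
Qed.

(** * Atoms: sets of minimal excess *)

Lemma ex_minimal (T : Type) (Q : T -> Prop) (mu : T -> nat) :
  (exists x, Q x) -> exists2 x, Q x & forall y, Q y -> mu x <= mu y.
Proof.
move=> [x0 Qx0]; have [n] := ubnP (mu x0); elim: n x0 Qx0 => // n IHn x Qx ltxn.
case: (classic (exists2 y, Q y & mu y < mu x)) => [[y Qy ltyx]|noy].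
  by apply: (IHn y) => //; apply: leq_trans ltyx _.
exists x => // y Qy; rewrite leqNgt; apply/negP=> ltyx; apply: noy; by exists y.
Qed.

(** The class [P] is a parameter: nonempty sets when no finite subgroup contains [M] and [N],
    [bounded] sets otherwise. *)
Definition atom P S :=
  [/\ P S, forall X, P X -> excess S <= excess X
    & forall X, P X -> excess X = excess S -> #|` S| <= #|` X|].

Lemma ex_atom P S0 : P S0 -> exists S, atom P S.
Proof.
move=> PS0; have [|S1 PS1 min1] := @ex_minimal _ P excess; first by exists S0.
have [|S [PS eS] minS] := @ex_minimal _ (fun X => P X /\ excess X = excess S1)
  (fun X => #|` X|); first by exists S1.
by exists S; split=> // X PX; rewrite eS; [exact: min1 | move=> eX; exact: minS].
Qed.

Lemma setprodI_atom P S : (P S -> P ((M ** S) `&` (N ** S))) -> atom P S ->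
  (M ** S) `&` (N ** S) = S.
Proof.
move=> Pclos [PS minS _]; have := minS _ (Pclos PS).
have := excess_setprodI S; have := excessE S => e1 e2 le.
by apply/esym/eqP; rewrite eqEfcard sub_setprodI; lia.
Qed.

(* Distinct translates of an atom are disjoint, so that the translate of an
   atom that contains 1 is stable under division. *)
Lemma atom_subgroup P S0 :
    P S0 ->
    (forall S, P S -> S != fset0) ->
    (forall S x, P S -> x \in S -> P (S ** [fset x^-1])) ->
    (forall S, P S -> P ((M ** S) `&` (N ** S))) ->
    (forall S T, atom P S -> atom P T -> S `&` T != fset0 ->
       P (S `&` T) /\ excess S <= excess (S `|` T)) ->
  exists F, [/\ is_subgroup F, atom P F & M `&` N `<=` F].
Proof.
move=> PS0 P_neq0 Ptrans Pclos uncross.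
have atrans S x : atom P S -> x \in S -> atom P (S ** [fset x^-1]).
  move=> [PS minS minS'] xS; split; rewrite ?excess_rcoset ?card_rcoset //.
  exact: Ptrans.
have [A aA] := ex_atom P S0 PS0; have [/P_neq0/fset0Pn[x xA] _ _] := aA.
set F := A ** [fset x^-1]; have aF : atom P F by exact: atrans.
have F1 : 1 \in F by rewrite mem_rcoset invgK mul1g.
move: F aF F1 => F aF F1; exists F; split=> //.
- split=> // z y zF yF.
  have aFy := atrans _ _ aF yF.
  have Fy1 : 1 \in F ** [fset y^-1] by rewrite mem_rcoset invgK mul1g.
  have [|PI leU] := uncross _ _ aF aFy.
    by apply/fset0Pn; exists 1; rewrite in_fsetI F1.
  have [_ minF minF'] := aF.
  (* Submodularity and [leU] give [F & F y^-1] the minimal excess, so it is no smaller than [F] and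
     equals [F y^-1]; this puts [z y^-1] in [F]. *)
  have := excess_submodular F (F ** [fset y^-1]).
  rewrite excess_rcoset => sub.
  have /(minF' _ PI) leFI : excess (F `&` F ** [fset y^-1]) = excess F.
    by have := minF _ PI; lia.
  have : F `&` (F ** [fset y^-1]) == F ** [fset y^-1].
    by rewrite eqEfcard fsubsetIr card_rcoset leFI.
  move/eqP/fsetP/(_ (z * y^-1)); rewrite in_fsetI mem_rcoset invgK mulgVK.
  by rewrite (zF : z \in F) andbT.
(* As [1] is in [F], [M] lies in [M F] and [N] in [N F], whose intersection is [F]. *)
- rewrite -(setprodI_atom _ _ (Pclos F) aF).
  by rewrite fsetISS //; apply: setprod_subr.
Qed.

Lemma subgroup_excess F : is_subgroup F -> M `&` N `<=` F ->
    ~~ (M `<=` N) -> ~~ (N `<=` M) -> ~~ ((M `<=` F) && (N `<=` F)) ->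
  #|` M| + #|` N| <= excess F + #|` M `&` N|.*2.
Proof.
move=> gF sHF nMN nNM nMNF.
have gMF := subgroupI _ _ gM gF; have gNF := subgroupI _ _ gN gF.
have := excessE F; have := card_setprodI _ _ gM gF; have := card_setprodI _ _ gN gF.
have := card_setprodI _ _ gMF gNF.
have -> : (M `&` F) `&` (N `&` F) = M `&` N.
  apply/fsetP=> z; rewrite !in_fsetI; have := fsubsetP sHF z; rewrite in_fsetI.
  by case: (z \in M); case: (z \in N); case: (z \in F) => // /(_ isT).
have : #|` (M `&` F) ** (N `&` F)| <= #|` F|.
  by apply: fsubset_leq_card; apply: setprod_sub => //; exact: fsubsetIr.
have : #|` M `&` N| <= #|` M `&` F|.
  by apply: fsubset_leq_card; rewrite fsubsetI fsubsetIl sHF.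
have : #|` M `&` N| <= #|` N `&` F|.
  by apply: fsubset_leq_card; rewrite fsubsetI fsubsetIr sHF.
have := proper_subgroup_card _ _ gM gN nMN.
have := proper_subgroup_card _ _ gN gM nNM; rewrite (fsetIC N M).
have := subgroup_card_gt0 _ (subgroupI _ _ gM gN).
have dich X : is_subgroup X ->
    X `<=` F /\ #|` X `&` F| = #|` X| \/ ~~ (X `<=` F) /\ #|` X `&` F|.*2 <= #|` X|.
  move=> gX; have [sXF|nXF] := boolP (X `<=` F); last first.
    by right; split=> //; exact: proper_subgroup_card.
  by left; split=> //; rewrite (fsetIidPl _).
have := dich M gM; have := dich N gN.
move: nMNF; move: #|` M `&` N| #|` M `&` F| #|` N `&` F| #|` F| #|` M| #|` N|
  #|` M ** F| #|` N ** F| #|` _ ** _| (excess F).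
move=> h a b f m n mf nf p c nMNF dN dM h0 hn hm hb ha pf Ep EN EM Ec.
have Efab : (a * b <= f * h)%N by rewrite -Ep leq_mul2r pf orbT.
(* [c a b h = f h (m b + n a - 2 a b) >= a b (m b + n a - 2 a b)] *)
have Ech : (m * b + n * a <= c * h + (a * b).*2)%N.
  have ab0 : (0 < a * b)%N by nia.
  rewrite -(leq_pmul2r ab0).
  have E1 : (c * (a * b) + (f * (a * b)).*2 = f * (m * b + n * a))%N by nia.
  have le : ((a * b).*2 <= m * b + n * a)%N by nia.
  nia.
(* If [M] is not inside [F], then [m >= 2a] and [n >= 2h] give [m(b-h) + n(a-h) >= 2a(b-h) + 2h(a-h)
   = 2(ab - h^2)]; the other case is symmetric. *)
have : (h * (m + n) <= h * (c + h.*2))%N by nia.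
by rewrite leq_pmul2l.
Qed.

Lemma excess_ge_unbounded S :
    ~~ (M `<=` N) -> ~~ (N `<=` M) ->
    (forall F, is_subgroup F -> ~~ ((M `<=` F) && (N `<=` F))) ->
    S != fset0 ->
  #|` M| + #|` N| <= excess S + #|` M `&` N|.*2.
Proof.
move=> nMN nNM noF S_neq0.
have [||||F [gF [_ minF _] sF]] := atom_subgroup (fun X => X != fset0) S S_neq0 => //.
- move=> X x _ xX; apply/fset0Pn; exists 1.
  by rewrite mem_rcoset invgK mul1g.
- move=> X /fset0Pn[x xX]; apply/fset0Pn; exists x.
  exact: (fsubsetP (sub_setprodI X)).
- move=> X Y [_ minX _] _ /fset0Pn[x xXY]; split; first by apply/fset0Pn; exists x.
  apply: minX; apply/fset0Pn; exists x; apply/fsetUP; left.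
  by move: xXY; rewrite in_fsetI => /andP[].
by have := subgroup_excess _ gF sF nMN nNM (noF _ gF); have := minF _ S_neq0; lia.
Qed.

(** * Duality inside a finite subgroup containing [M] and [N] *)

Section FiniteJoin.

Context (K : {fset G}) (gK : is_subgroup K) (sMK : M `<=` K) (sNK : N `<=` K).

(** The dual of [S] in [K]. Asking that it be nonempty excludes [K] itself, whose excess is 0. *)
Definition outside S : {fset G} := K `\` ((M ** S) `|` (N ** S)).

Definition bounded S := [&& S `<=` K, S != fset0 & outside S != fset0].

Lemma card_outside S : S `<=` K ->
  (#|` outside S| + #|` (M ** S) `|` (N ** S)| = #|` K|)%N.
Proof.
move=> sSK; have sub : (M ** S) `|` (N ** S) `<=` K.
  by rewrite fsubUset !(setprod_sub gK).
by rewrite cardfsDS // subnK //; exact: fsubset_leq_card.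
Qed.

Lemma card_setprod_outside X S : is_subgroup X -> X `<=` K -> S `<=` K ->
    X ** S `<=` (M ** S) `|` (N ** S) ->
  #|` X ** outside S| + #|` X ** S| <= #|` K|.
Proof.
move=> gX sXK sSK sXS; rewrite -cardfsUI.
have -> : (X ** outside S) `&` (X ** S) = fset0.
  apply/fsetP=> z; rewrite in_fsetI; apply/negP=> /andP[/setprodP[a aX [b + ->]]].
  rewrite mem_setprodM // in_fsetD => /andP[/negP nb _] bXS; apply: nb.
  exact: (fsubsetP sXS).
rewrite cardfs0 addn0; apply: fsubset_leq_card.
by rewrite fsubUset !(setprod_sub gK) // fsubsetDl.
Qed.

(** Counting complements in [K] bounds the excess of the dual by the size of the symmetric
    difference of [M S] and [N S]. *)
Lemma excess_outside S : S `<=` K -> excess (outside S) <= excess S.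
Proof.
move=> sSK; have := card_outside _ sSK.
have := card_setprod_outside _ _ gM sMK sSK (fsubsetUl _ _).
have := card_setprod_outside _ _ gN sNK sSK (fsubsetUr _ _).
have := cardfsUI (M ** S) (N ** S); have := fsubset_leq_card (sub_setprodI S).
have := excessE S; have := excessE (outside S); lia.
Qed.

(** The dual of the dual contains [S]. *)
Lemma bounded_outside S : bounded S -> bounded (outside S).
Proof.
move=> /and3P[sSK /fset0Pn[x xS] nS]; rewrite /bounded nS fsubsetDl /=.
apply/fset0Pn; exists x; rewrite in_fsetD (fsubsetP sSK) // andbT in_fsetU.
have notin X y : is_subgroup X -> y \in X ** outside S ->
    exists2 a, a \in X & a * y \in outside S.
  move=> gX /setprodP[a aX [b bS ->]]; exists a^-1; first exact: subgroupV.
  by rewrite mulKg.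
apply/norP; split; apply/negP=> /notin[] // a aX; rewrite in_fsetD in_fsetU.
  by rewrite mem_setprod.
by rewrite orbC mem_setprod.
Qed.

Lemma bounded_setprodI S : bounded S -> bounded ((M ** S) `&` (N ** S)).
Proof.
move=> /and3P[sSK /fset0Pn[x xS] out]; rewrite /bounded /outside.
rewrite setprodIl setprodIr out andbT; apply/andP; split.
  by apply: (fsubset_trans (fsubsetIl _ _)); exact: setprod_sub.
by apply/fset0Pn; exists x; exact: (fsubsetP (sub_setprodI S)).
Qed.

(** The dual of an atom also has minimal excess, hence at least [|S|] elements; and
    [|M S| + |N S| = |M S + N S| + |S|], with [+] inside the bars for union, because [S] is
    closed. *)
Lemma atom_bounded_card S : atom bounded S -> #|` M ** S| + #|` N ** S| <= #|` K|.
Proof.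
move=> aS; have [bS minS minS'] := aS; have /and3P[sSK _ _] := bS.
have /(minS' _ (bounded_outside _ bS)) le : excess (outside S) = excess S.
  by have := minS _ (bounded_outside _ bS); have := excess_outside _ sSK; lia.
rewrite -cardfsUI (setprodI_atom _ _ (bounded_setprodI S) aS).
by rewrite -(card_outside _ sSK); lia.
Qed.

Lemma excess_ge_bounded S :
    ~~ (M `<=` N) -> ~~ (N `<=` M) ->
    (forall F, is_subgroup F -> M `<=` F -> N `<=` F -> #|` K| <= #|` F|) ->
    bounded S ->
  #|` M| + #|` N| <= excess S + #|` M `&` N|.*2.
Proof.
move=> nMN nNM minK bS; rewrite leqNgt; apply/negP=> ltS.
have [|X x|||F [gF [/and3P[sFK _ /fset0Pn[z zF]] minF _] sF]] :=
    atom_subgroup bounded S bS.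
- by move=> X /and3P[].
- move=> /and3P[sXK _ /fset0Pn[z zX]] xX; apply/and3P; split.
  + apply: setprod_sub => //; rewrite fsub1set subgroupV //.
    exact: (fsubsetP sXK).
  + by apply/fset0Pn; exists 1; rewrite mem_rcoset invgK mul1g.
  + apply/fset0Pn; exists (z * x^-1); move: zX; rewrite !in_fsetD !in_fsetU.
    rewrite !setprodA !mem_rcoset invgK mulgVK => /andP[-> zK] /=.
    by apply: subgroupM => //; rewrite subgroupV // (fsubsetP sXK).
- exact: bounded_setprodI.
- move=> X Y aX aY /fset0Pn[x xXY].
  have [bX minX _] := aX; have [bY minY _] := aY.
  have /and3P[sXK _ oX] := bX; have /and3P[sYK _ oY] := bY.
  move: (xXY); rewrite in_fsetI => /andP[xX xY].
  split.
    apply/and3P; split; first by apply: fsubset_trans sXK; exact: fsubsetIl.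
      by apply/fset0Pn; exists x.
    have [z zX] := fset0Pn _ oX; apply/fset0Pn; exists z; move: zX.
    rewrite !in_fsetD !in_fsetU => /andP[+ ->]; rewrite andbT.
    by apply: contra => /orP[] h; apply/orP; [left|right];
      apply: (fsubsetP (setprodS (fsubset_refl _) (fsubsetIl X Y))).
  have sUK : X `|` Y `<=` K by rewrite fsubUset sXK.
  have [o0|on0] := eqVneq (outside (X `|` Y)) fset0; last first.
    apply: minX; rewrite /bounded sUK on0 andbT.
    by apply/fset0Pn; exists x; rewrite in_fsetU xX.
  (* [excess (X `|` Y)] is then at least [#|` M| + #|` N|]. *)
  have := card_outside _ sUK; rewrite o0 cardfs0 add0n => eK.
  (* [Z X] and [Z Y] share the coset [Z x]. With [U] the union, this and [atom_bounded_card] give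
     [|M U| + |N U| <= 2|K| - |M| - |N|]; as [M U] and [N U] cover [K], their symmetric difference
     has at least [|M| + |N|] elements. *)
  have meet Z : is_subgroup Z ->
      (#|` Z ** (X `|` Y)| + #|` Z| <= #|` Z ** X| + #|` Z ** Y|)%N.
    move=> gZ; rewrite setprodU -(cardfsUI (Z ** X)) leq_add2l -(card_rcoset _ Z x).
    by apply: fsubset_leq_card; rewrite fsubsetI !setprodS ?fsub1set.
  have := meet M gM; have := meet N gN.
  have := atom_bounded_card _ aX; have := atom_bounded_card _ aY.
  have := excess_symdiff (X `|` Y); have := minX _ bS.
  have := cardfsID (N ** (X `|` Y)) (M ** (X `|` Y)).
  have := cardfsID (M ** (X `|` Y)) (N ** (X `|` Y)).
  rewrite (fsetIC (N ** _)); have := cardfsUI (M ** (X `|` Y)) (N ** (X `|` Y)).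
  move: eK ltS; clear; lia.
have lt : excess F + #|` M `&` N|.*2 < #|` M| + #|` N|.
  by have := minF _ bS; move: ltS; clear; lia.
have : (M `<=` F) && (N `<=` F).
  by apply/negPn/negP=> /(subgroup_excess _ gF sF nMN nNM); rewrite leqNgt lt.
(* By minimality of [K], [F] is all of [K], which leaves no room for [z] outside. *)
case/andP=> sMF sNF; have /eqP eFK : F == K by rewrite eqEfcard sFK minK.
move: zF; rewrite eFK in_fsetD in_fsetU => /andP[+ zK].
by rewrite (fsubsetP (sub_setprod _ K gM)).
Qed.

(** The parts of [S] inside and outside [K z] have disjoint products with [M], and likewise with
    [N], so their excesses add up to at most that of [S]. *)
Lemma excess_component S (z : G) : excess (S `&` (K ** [fset z])) <= excess S.
Proof.
set S1 := S `&` _; set S2 := S `\` (K ** [fset z]).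
have le X : is_subgroup X -> X `<=` K -> #|` X ** S1| + #|` X ** S2| <= #|` X ** S|.
  move=> gX sXK; rewrite -cardfsUI -setprodU.
  have -> : (X ** S1) `&` (X ** S2) = fset0.
    apply/fsetP=> y; rewrite in_fsetI; apply/negP=> /andP[].
    move=> /setprodP[a aX [b + ->]] /setprodP[c cX [d + e]].
    rewrite in_fsetI in_fsetD !mem_rcoset => /andP[_ bK] /andP[/negP nd _]; apply: nd.
    rewrite -[d](mulKg c) -e -!mulgA; apply: subgroupM; rewrite ?subgroupV //.
      exact: (fsubsetP sXK).
    by apply: subgroupM => //; exact: (fsubsetP sXK).
  rewrite cardfs0 addn0; apply: fsubset_leq_card; apply: setprodS => //.
  by rewrite fsubUset fsubsetIl fsubsetDl.
have := le M gM sMK; have := le N gN sNK; have := cardfsID (K ** [fset z]) S.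
rewrite -/S1 -/S2; have := excessE S; have := excessE S1; have := excessE S2.
clear; lia.
Qed.

End FiniteJoin.

(** * The lower bound for the excess *)

Lemma excess_ge S : ~~ (M ** S `<=` N ** S) -> ~~ (N ** S `<=` M ** S) ->
  #|` M| + #|` N| <= excess S + #|` M `&` N|.*2.
Proof.
move=> nMN nNM.
have nMN' : ~~ (M `<=` N) by apply: contra nMN => sMN; exact: setprodS.
have nNM' : ~~ (N `<=` M) by apply: contra nNM => sNM; exact: setprodS.
have /fsubsetPn[z zM zN] := nMN; have /fsubsetPn[y yN yM] := nNM.
rewrite leqNgt; apply/negP=> lt.
case: (classic (exists K, [/\ is_subgroup K, M `<=` K & N `<=` K])) => [exK|noK];
    last first.
  move: lt; rewrite ltnNge => /negP[]; apply: excess_ge_unbounded => //.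
    by move=> F gF; apply/andP=> -[sMF sNF]; apply: noK; exists F.
  by have [_ _ [x xS _]] := setprodP zM; apply/fset0Pn; exists x.
have [K [gK sMK sNK] minK] := ex_minimal _ _ (fun K => #|` K|) exK.
(* Translated into [K], the part of [S] in [K x] is either [bounded], against [lt], or has empty
   dual, which is the covering claimed. *)
have cover x : x \in (M ** S) `|` (N ** S) -> K ** [fset x] `<=` (M ** S) `|` (N ** S).
  move=> xS; set X := S `&` (K ** [fset x]).
  have [s sS sx] : exists2 s, s \in S & s * x^-1 \in K.
    have hit Z : is_subgroup Z -> Z `<=` K -> x \in Z ** S ->
        exists2 s, s \in S & s * x^-1 \in K.
      move=> gZ sZK /setprodP[a aZ [s sS ->]]; exists s => //.
      by rewrite invMg mulgA mulgV mul1g subgroupV // (fsubsetP sZK).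
    by case/fsetUP: xS; apply: hit.
  have sXK : X ** [fset x^-1] `<=` K.
    apply/fsubsetP=> w; rewrite mem_rcoset invgK in_fsetI mem_rcoset.
    by rewrite mulgK => /andP[].
  have [out0|out] := eqVneq (outside K (X ** [fset x^-1])) fset0; last first.
    move: lt; rewrite ltnNge => /negP[].
    apply: (leq_trans (excess_ge_bounded K gK sMK sNK (X ** [fset x^-1]) _ _ _ _)) => //.
    - by move=> F gF sMF sNF; apply: minK.
    - apply/and3P; split=> //; apply/fset0Pn; exists (s * x^-1).
      by rewrite mem_rcoset invgK mulgVK in_fsetI sS mem_rcoset.
    - by rewrite excess_rcoset leq_add2r; exact: excess_component.
  apply/fsubsetP=> w; rewrite mem_rcoset => wK; move/fsetP/(_ (w * x^-1)): out0.
  rewrite in_fsetD wK andbT in_fset0 in_fsetU !setprodA !mem_rcoset invgK mulgVK.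
  move/negbFE/orP=> wX; apply/fsetUP.
  by case: wX => wX; [left|right]; apply: (fsubsetP (setprodS (fsubset_refl _)
    (fsubsetIl S (K ** [fset x])))).
(* The coset [B x] lies in [K x] and misses [B S], so it lies in [A S]. *)
have lem A B x : is_subgroup B -> B `<=` K -> x \notin B ** S ->
    K ** [fset x] `<=` (A ** S) `|` (B ** S) -> #|` B| <= #|` (A ** S) `\` (B ** S)|.
  move=> gB sBK xB /fsubsetP sub; rewrite -(card_rcoset _ B x).
  apply: fsubset_leq_card; apply/fsubsetP=> w; rewrite mem_rcoset => wx.
  have wB : w \notin B ** S by rewrite -(mulgVK x w) mem_setprodM.
  have := sub w; rewrite mem_rcoset (fsubsetP sBK) // in_fsetU (negPf wB) orbF.
  by rewrite in_fsetD wB => ->.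
have := lem M N z gN sNK zN; have := lem N M y gM sMK yM.
rewrite (fsetUC (N ** S)) !cover ?in_fsetU ?zM ?yN ?orbT // => /(_ isT) h1 /(_ isT) h2.
have := excess_symdiff S; move: lt h1 h2; clear; lia.
Qed.

End Excess.

(** * Cells, boundaries and the conclusion *)

Lemma cellI (G : groupType) (S X Y : {fset G}) :
  cell S X -> cell S Y -> cell S (X `&` Y).
Proof.
move=> cX cY z; rewrite in_fsetI negb_and => /orP[/cX|/cY]; apply: contra => sub.
  by apply: fsubset_trans sub (setprodS _ _); [exact: fsubsetIl |].
by apply: fsubset_trans sub (setprodS _ _); [exact: fsubsetIr |].
Qed.

(** Turns incomparability of [M] and [N] into that of [M S] and [N S], as [excess_ge] requires. *)
Lemma cell_setprod_sub (G : groupType) (S X Y : {fset G}) :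
  cell S Y -> X ** S `<=` Y ** S -> X `<=` Y.
Proof.
move=> cY sub; apply/fsubsetP=> z zX; apply/negPn/negP=> /cY/negP[].
by apply: fsubset_trans sub; apply: setprodS => //; rewrite fsub1set.
Qed.

(* Both sides are congruent to 0 modulo the order of [H], and
   [|H S| >= |S| > |M S| - |M|]. *)
Lemma subgroup_boundary_mono (G : groupType) (S H M : {fset G}) :
    is_subgroup H -> is_subgroup M -> H `<=` M ->
    #|` M ** S| + 1 <= #|` S| + #|` M| ->
  #|` M ** S| + #|` H| <= #|` H ** S| + #|` M|.
Proof.
move=> gH gM sHM le.
have HM : H ** M = M.
  apply/eqP; rewrite eqEfsubset sub_setprod // andbT.
  exact: setprod_sub.
have /dvdnP[a ea] := dvdn_card_invariant _ _ gH HM.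
have /dvdnP[b eb] : #|` H| %| #|` M ** S|.
  by apply: dvdn_card_invariant; rewrite // setprodA HM.
have /dvdnP[c ec] : #|` H| %| #|` H ** S|.
  by apply: dvdn_card_invariant => //; exact: setprodK.
have := fsubset_leq_card (sub_setprod _ S gH).
move: le; rewrite ea eb ec; move: #|` H| #|` S| => h s; clear => le1 le2.
(* [b h + 1 <= s + a h <= (c + a) h]; being strict between multiples of [h], the inequality gains a
   full [h]. *)
have : (b < c + a)%N by rewrite ltnNge; apply/negP=> le; nia.
nia.
Qed.

Theorem theorem4 (G : groupType) (S : {fset G}) (hS : 1 \in S)
    (u v : int) (M N : {fset G})
    (hMker : ukernel S u M) (hMgrp : is_subgroup M)
    (hNgrp : is_subgroup N) (hNcell : ucell S v N)
    (hu : (u <= #|` S|%:Z - 1)%R) (hv : (v <= #|` S|%:Z - 1)%R) :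
  (ukernel S v N \/ u = v -> M `<=` N \/ N `<=` M) /\
  (ukernel S v N -> (v <= u)%R -> M `<=` N).
Proof.
have [[cM eu] minM] := hMker; have [cN ev] := hNcell.
have gH := subgroupI _ _ hMgrp hNgrp.
have leu := subgroup_boundary_mono _ S _ _ gH hMgrp (fsubsetIl M N).
have lev := subgroup_boundary_mono _ S _ _ gH hNgrp (fsubsetIr M N).
have {}leu : #|` M ** S| + #|` M `&` N| <= #|` (M `&` N) ** S| + #|` M|.
  by apply: leu; move: eu hu; clear; lia.
have {}lev : #|` N ** S| + #|` M `&` N| <= #|` (M `&` N) ** S| + #|` N|.
  by apply: lev; move: ev hv; clear; lia.
(* Equal boundaries make [M & N] a [u]-cell, which cannot be smaller than the kernel [M]. *)
have kerM : (#|` M ** S| + #|` M `&` N| = #|` (M `&` N) ** S| + #|` M|)%N -> M `<=` N.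
  move=> e; have : M `&` N == M.
    rewrite eqEfcard fsubsetIl /=; apply: minM; split; first exact: cellI.
    by move: eu e; clear; lia.
  by move/eqP/fsetIidPl.
have comparable : M `<=` N \/ N `<=` M.
  have [sMN|nMN] := boolP (M `<=` N); [by left | right].
  apply/negPn/negP => nNM.
  pose E := (M `&` N) ** S.
  have ME : M ** E = M ** S.
    rewrite setprodA; congr (_ ** _); apply/eqP; rewrite eqEfsubset.
    rewrite (setprod_sub hMgrp) ?fsubsetIl //=.
    by apply: setprod_subr => //; exact: subgroup1.
  have NE : N ** E = N ** S.
    rewrite setprodA; congr (_ ** _); apply/eqP; rewrite eqEfsubset.
    rewrite (setprod_sub hNgrp) ?fsubsetIr //=.
    by apply: setprod_subr => //; exact: subgroup1.
  have := excess_ge M N hMgrp hNgrp E; rewrite ME NE => ge.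
  have {}ge : #|` M| + #|` N| <= excess M N E + #|` M `&` N|.*2.
    apply: ge; [apply: contra nMN | apply: contra nNM]; exact: cell_setprod_sub.
  have := excessE M N hMgrp hNgrp E; rewrite ME NE => eE.
  case/negP: nMN; apply: kerM.
  (* [ge] and [eE] say [2w <= u + v], while [leu] and [lev] say [w >= u] and [w >= v]; hence
     [w = u]. *)
  by move: leu lev ge eE; rewrite -/E; clear; lia.
(* If [N] lies in [M], then [M & N = N] and [leu] reads [u <= v]; with [v <= u] the boundaries
   agree. *)
split=> // _ levu; case: comparable => // /fsetIidPr eH; apply: kerM.
by move: leu levu; rewrite eH -eu -ev; clear; lia.
Qed.
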